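(* Let $\mathcal{V}$ be a Euclidean Jordan algebra of rank $n$. Fix a Jordan frame in $\mathcal{V}$ relative to which Schur products are taken. Let $A=[a_{ij}]$ and $B=[b_{ij}]$ be real symmetric $n\times n$ matrices with $b_{ij}\neq 0$ for all $i,j$, and suppose that the matrix $\left[\frac{a_{ij}}{b_{ij}}\right]$ is a correlation matrix. Let $k\in\mathbb{N}$ ($k\ge1$). Then $$A^{(k)}\bullet x\prec B^{(k)}\bullet x\quad\text{for all }x\in\mathcal{V}.$$ Moreover, if $a_{ij}\neq0$ for all $i,j$, then $$B^{(-k)}\bullet x\prec A^{(-k)}\bullet x\quad\text{for all }x\in\mathcal{V}.$$
   Context: A Euclidean Jordan algebra $(\mathcal{V},\circ,\langle\cdot,\cdot\rangle)$ is a finite-dimensional real inner product space with a commutative bilinear product $\circ$ satisfying $x\circ(x^2\circ y)=x^2\circ(x\circ y)$ and $\langle x\circ y,z\rangle=\langle y,x\circ z\rangle$, with unit element $e$. A Jordan frame is a set $\{e_1,\ldots,e_n\}$ of primitive idempotents with $e_i\circ e_j=0$ for $i\ne j$ and $\sum_i e_i=e$; all Jordan frames have the same number $n$ of elements, the rank of $\mathcal{V}$. Spectral decomposition: every $x\in\mathcal{V}$ can be written $x=\sum_{i=1}^n x_ie_i$ for some Jordan frame $\{e_1,\ldots,e_n\}$ and real numbers $x_i$, called the eigenvalues of $x$ (uniquely determined with multiplicity). $\lambda(x)\in\mathbb{R}^n$ is the vector of eigenvalues of $x$ in decreasing order, and $\operatorname{tr}(x)$ is the sum of the eigenvalues. The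 inner product on $\mathcal{V}$ is assumed to be $\langle x,y\rangle=\operatorname{tr}(x\circ y)$. Majorization: for $p,q\in\mathbb{R}^n$, $p\prec q$ means $\sum_{i=1}^k p_i^\downarrow\le\sum_{i=1}^k q_i^\downarrow$ for all $1\le k\le n$ with equality for $k=n$, where $p^\downarrow$ is the decreasing rearrangement of $p$. For $x,y\in\mathcal{V}$, $x\prec y$ means $\lambda(x)\prec\lambda(y)$. Peirce decomposition and Schur product: given a Jordan frame $\{e_1,\ldots,e_n\}$, $\mathcal{V}$ is the orthogonal direct sum $\mathcal{V}=\sum_{i\le j}\mathcal{V}_{ij}$ with $\mathcal{V}_{ii}=\{x: x\circ e_i=x\}=\mathbb{R}e_i$ and $\mathcal{V}_{ij}=\{x: x\circ e_i=\tfrac12x=x\circ e_j\}$ for $i<j$. Writing $x=\sum_{i\le j}x_{ij}$ with $x_{ij}\in\mathcal{V}_{ij}$, for a real symmetric $n\times n$ matrix $A=[a_{ij}]$ the Schur product is $A\bullet x:=\sum_{i\le j}a_{ij}x_{ij}$. A correlation matrix is a real symmetric positive semidefinite matrix all of whose diagonal entries equal $1$. For $k\in\mathbb{N}$, $A^{(k)}:=[a_{ij}^k]$ is the entrywise $k$th power, and when all $a_{ij}\ne0$, $A^{(-k)}:=[a_{ij}^{-k}]$. *)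

(* Defs.v *)
From HB Require Import structures.
From mathcomp Require Import all_boot all_order all_algebra.
From mathcomp Require Import classical_sets reals.

Set Implicit Arguments.
Unset Strict Implicit.
Unset Printing Implicit Defensive.

Import Order.TTheory GRing.Theory Num.Theory.
Local Open Scope ring_scope.

Record euclideanJordanAlgebra (R : realType) := EuclideanJordanAlgebra {
  eja_space :> vectType R;
  jmul : {bilinear eja_space -> eja_space -> eja_space};
  jdot : {dot eja_space for idfun};
  jone : eja_space;
  jmulC : forall x y, jmul x y = jmul y x;
  jmul1x : forall x, jmul jone x = x;
  jordan_identity : forall x y,
    jmul x (jmul (jmul x x) y) = jmul (jmul x x) (jmul x y);
  jdot_assoc : forall x y z, jdot (jmul x y) z = jdot y (jmul x z)
}.

Section Spectrum.
Context {R : realType} {V : euclideanJordanAlgebra R}.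
Implicit Types (c x y : V).

Definition jidempotent c : Prop := jmul V c c = c.

Definition jprimitive c : Prop :=
  [/\ c <> 0, jidempotent c
    & ~ exists a b : V, [/\ a <> 0, b <> 0, jidempotent a, jidempotent b
                          & c = a + b]].

(* A frame is listed by 'I_n; orthogonality of nonzero idempotents makes the
   listing injective. *)
Definition jordan_frame n (f : 'I_n -> V) : Prop :=
  [/\ forall i, jprimitive (f i),
      forall i j, i != j -> jmul V (f i) (f j) = 0
    & \sum_i f i = jone V].

(* lambda(x), for V of rank n. By the spectral theorem exactly one tuple
   satisfies the condition, so the default value of xget is never used. *)
Definition eigenvalues n x : n.-tuple R :=
  xget (nseq_tuple n (0 : R))
    [set l : n.-tuple R | sorted >=%R l /\
       exists f : 'I_n -> V,
         jordan_frame f /\ x = \sum_(i < n) tnth l i *: f i]%classic.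

Definition jtrace n x : R := \sum_(i < n) tnth (eigenvalues n x) i.

End Spectrum.

(* All Jordan frames of V have the same number of elements, so exhibiting one
   determines the rank. *)
Definition has_rank (R : realType) (V : euclideanJordanAlgebra R) (n : nat) :
  Prop := exists f : 'I_n -> V, jordan_frame f.

(* Entry i of the decreasing rearrangement, 0-based. *)
Definition decr (R : realType) n (p : n.-tuple R) (i : nat) : R :=
  nth 0 (sort >=%R p) i.

Definition majorized (R : realType) n (p q : n.-tuple R) : Prop :=
  (forall k, (1 <= k <= n)%N ->
     \sum_(i < k) decr p i <= \sum_(i < k) decr q i) /\
  \sum_(i < n) decr p i = \sum_(i < n) decr q i.

Definition jmajorized (R : realType) (V : euclideanJordanAlgebra R) (n : nat)
    (x y : V) : Prop :=
  majorized (eigenvalues n x) (eigenvalues n y).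

Section Peirce.
Context {R : realType} {V : euclideanJordanAlgebra R} {n : nat}.
Variable e : 'I_n -> V.

Definition peirce_space (i j : 'I_n) : {vspace V} :=
  if i == j then passmx.leigenspace (linfun (jmul V (e i))) 1
  else (passmx.leigenspace (linfun (jmul V (e i))) 2^-1
        :&: passmx.leigenspace (linfun (jmul V (e j))) 2^-1)%VS.

(* x_ij for i <= j: the projection associated with the direct sum of the
   Peirce spaces, which is all of V when e is a Jordan frame. *)
Definition peirce_comp (i j : 'I_n) (x : V) : V :=
  sumv_pi (\sum_(p : 'I_n * 'I_n | (p.1 <= p.2)%N) peirce_space p.1 p.2)%VS
    (i, j) x.

Definition schur (A : 'M[R]_n) (x : V) : V :=
  \sum_(p : 'I_n * 'I_n | (p.1 <= p.2)%N)
    A p.1 p.2 *: peirce_comp p.1 p.2 x.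

End Peirce.

Definition psdmx (R : realType) n (C : 'M[R]_n) : Prop :=
  forall u : 'cV[R]_n, 0 <= (u^T *m C *m u) 0 0.

Definition correlation_mx (R : realType) n (C : 'M[R]_n) : Prop :=
  [/\ C^T = C, psdmx C & forall i, C i i = 1].

Definition entry_exp (R : realType) n (k : nat) (A : 'M[R]_n) : 'M[R]_n :=
  \matrix_(i, j) (A i j ^+ k).

Definition entry_expN (R : realType) n (k : nat) (A : 'M[R]_n) : 'M[R]_n :=
  \matrix_(i, j) (A i j ^- k).

(* Main.v *)
Require Import Defs.
From mathcomp Require Import all_boot all_order all_algebra.
From mathcomp Require Import classical_sets reals.
From mathcomp Require Import ring lra complex boolp.

(** Write [A^(k) = C^(k) o B^(k)] entrywise with [C = [a_ij / b_ij]]. By the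
    Schur product theorem [C^(k)] is a correlation matrix, so it suffices that
    [C • y ≺ y] for every correlation matrix [C]. With spectral decompositions
    [y = sum_j l_j g_j] and [C • y = sum_i m_i f_i], the matrix
    [D i j = ⟨C • g_j, f_i⟩] satisfies [m = D l] and has row and column sums 1,
    so the point is that it is nonnegative. As [⟨C • x, y⟩] pairs [C] with a
    symmetric matrix built from [x] and [y], this reduces to [C = u u^T], for
    which [C • x] is the quadratic representation of [sum_i u_i e_i]. That map
    is a product of the maps [stretch e_i u_i] attached to single idempotents.
    Each of them sends a primitive idempotent [c] to a nonnegative multiple of
    an idempotent: projecting [c^2 = c] and [P_c p = s c] on the Peirce spaces
    of [p] gives [z^2 = (u^2 s + 1 - s) z] for [z = stretch p u c], without
    appeal to the fundamental formula. *)

Set Implicit Arguments.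
Unset Strict Implicit.
Unset Printing Implicit Defensive.

Import Order.TTheory GRing.Theory Num.Theory.
Local Open Scope ring_scope.

Local Notation "x ∘ y" := (jmul _ x y) (at level 40, left associativity).
Local Notation "⟨ x , y ⟩" := (jdot _ x y) (format "⟨ x ,  y ⟩").

(** * Bilinearity and the linearized Jordan identity *)

Section Algebra.
Context {R : realType} {V : euclideanJordanAlgebra R}.
Implicit Types (c p x y z w : V) (a b : R).

Lemma jmul0l x : 0 ∘ x = 0. Proof. exact: linear0l. Qed.
Lemma jmulDl x y z : (x + y) ∘ z = x ∘ z + y ∘ z.
Proof. exact: linearDl. Qed.
Lemma jmulNl x y : (- x) ∘ y = - (x ∘ y). Proof. exact: linearNl. Qed.
Lemma jmulZl a x y : (a *: x) ∘ y = a *: (x ∘ y).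
Proof. by rewrite linearZl_LR. Qed.
Lemma jmul0r x : x ∘ 0 = 0. Proof. exact: linear0. Qed.
Lemma jmulDr x y z : x ∘ (y + z) = x ∘ y + x ∘ z. Proof. exact: linearD. Qed.
Lemma jmulNr x y : x ∘ (- y) = - (x ∘ y). Proof. exact: linearN. Qed.
Lemma jmulZr a x y : x ∘ (a *: y) = a *: (x ∘ y).
Proof. by rewrite linearZr_LR. Qed.
Lemma jmulx1 x : x ∘ jone V = x. Proof. by rewrite jmulC jmul1x. Qed.

Lemma jmul_suml I (r : seq I) (P : pred I) (F : I -> V) x :
  (\sum_(i <- r | P i) F i) ∘ x = \sum_(i <- r | P i) F i ∘ x.
Proof. exact: (big_morph (fun y => y ∘ x) (fun y z => jmulDl y z x) (jmul0l x)). Qed.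
Lemma jmul_sumr I (r : seq I) (P : pred I) (F : I -> V) x :
  x ∘ (\sum_(i <- r | P i) F i) = \sum_(i <- r | P i) x ∘ F i.
Proof. exact: linear_sum. Qed.

Lemma dot0l x : ⟨0, x⟩ = 0. Proof. exact: linear0l. Qed.
Lemma dotDl x y z : ⟨x + y, z⟩ = ⟨x, z⟩ + ⟨y, z⟩. Proof. exact: linearDl. Qed.
Lemma dotNl x y : ⟨- x, y⟩ = - ⟨x, y⟩. Proof. exact: linearNl. Qed.
Lemma dotZl a x y : ⟨a *: x, y⟩ = a * ⟨x, y⟩. Proof. by rewrite linearZl_LR. Qed.
Lemma dotC x y : ⟨x, y⟩ = ⟨y, x⟩.
Proof. by rewrite hermC expr0 mul1r. Qed.
Lemma dotDr x y z : ⟨x, y + z⟩ = ⟨x, y⟩ + ⟨x, z⟩.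
Proof. exact: linearD. Qed.
Lemma dotNr x y : ⟨x, - y⟩ = - ⟨x, y⟩. Proof. exact: linearN. Qed.
Lemma dotZr a x y : ⟨x, a *: y⟩ = a * ⟨x, y⟩.
Proof. by rewrite dotC dotZl dotC. Qed.
Lemma dot0r x : ⟨x, 0⟩ = 0. Proof. exact: linear0. Qed.
Lemma dot_suml I (r : seq I) (P : pred I) (F : I -> V) x :
  ⟨\sum_(i <- r | P i) F i, x⟩ = \sum_(i <- r | P i) ⟨F i, x⟩.
Proof. exact: (big_morph (fun y => ⟨y, x⟩) (fun y z => dotDl y z x) (dot0l x)). Qed.
Lemma dot_sumr I (r : seq I) (P : pred I) (F : I -> V) x :
  ⟨x, \sum_(i <- r | P i) F i⟩ = \sum_(i <- r | P i) ⟨x, F i⟩.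
Proof. exact: linear_sum. Qed.

Lemma dot_gt0 x : x != 0 -> 0 < ⟨x, x⟩. Proof. exact: neq0_dnorm_gt0. Qed.
Lemma dot_ge0 x : 0 <= ⟨x, x⟩.
Proof. by have [->|/dot_gt0/ltW//] := eqVneq x 0; rewrite dot0l. Qed.
Lemma dot_eq0 x : ⟨x, x⟩ = 0 -> x = 0.
Proof. by move=> h; apply/eqP/negPn/negP => /dot_gt0; rewrite h ltxx. Qed.
Lemma dot_inj x y : (forall w, ⟨x, w⟩ = ⟨y, w⟩) -> x = y.
Proof.
move=> h; apply/eqP; rewrite -subr_eq0; apply/eqP/dot_eq0.
by rewrite dotDl dotNl h subrr.
Qed.

Lemma dot_mulA x y z : ⟨x ∘ y, z⟩ = ⟨y, x ∘ z⟩. Proof. exact: jdot_assoc. Qed.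

Definition linE := (jmulDl, jmulDr, jmulNl, jmulNr, jmulZl, jmulZr,
  jmul0l, jmul0r, dotDl, dotNl, dotZl, dot0l).
End Algebra.

(* Linear identities in [V] are checked after pairing with a generic vector,
   where [ring] applies. *)
Ltac jlin := apply: dot_inj => ?; rewrite ?linE; first [ring | lra].
Ltac jpair w h := let H := fresh in
  have H := congr1 (fun v => jdot _ v w) h; rewrite ?linE in H.
Tactic Notation "jlra" constr(h) :=
  let w := fresh "w" in
  apply: dot_inj => w; jpair w h; clear h; rewrite ?linE; lra.
Tactic Notation "jlra" constr(h) constr(h') :=
  let w := fresh "w" in
  apply: dot_inj => w; jpair w h; jpair w h'; clear h h'; rewrite ?linE; lra.
Tactic Notation "jlra" constr(h) constr(h') constr(h'') :=
  let w := fresh "w" in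
  apply: dot_inj => w; jpair w h; jpair w h'; jpair w h''; clear h h' h'';
  rewrite ?linE; lra.

Section Jordan.
Context {R : realType} {V : euclideanJordanAlgebra R}.
Implicit Types (c p x y z w : V) (a b : R).

(** Polarisation: the difference of the identities at [x + z] and [x - z] keeps the terms odd in
    [z], and the identity at [z] removes the cubic one. *)
Lemma jordan_linearized x y z :
  2 *: ((x ∘ z) ∘ (x ∘ y)) + (x ∘ x) ∘ (z ∘ y)
  = z ∘ ((x ∘ x) ∘ y) + 2 *: (x ∘ ((x ∘ z) ∘ y)).
Proof.
have H1 := jordan_identity (x + z) y.
have H2 := jordan_identity (x - z) y.
have H3 := jordan_identity z y.
rewrite !linE in H1 H2; rewrite ![z ∘ x]jmulC in H1 H2.
jlra H1 H2 H3.
Qed.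

End Jordan.

(** * Peirce decomposition of an idempotent *)

Section PeirceIdempotent.
Context {R : realType} {V : euclideanJordanAlgebra R}.
Implicit Types (c p u x y z w : V) (a b s t : R).

(** Multiplication by [p] is a root of 2t^3 - 3t^2 + t, so its eigenvalues lie in 0, 1/2, 1. *)
Lemma peirce_cubic p z : jidempotent p ->
  2 *: (p ∘ (p ∘ (p ∘ z))) = 3 *: (p ∘ (p ∘ z)) - p ∘ z.
Proof.
move=> pp; have := jordan_linearized p p z.
rewrite pp pp [z ∘ p]jmulC [(p ∘ z) ∘ p]jmulC => H.
jlra H.
Qed.

(** The linearized identity reads (1 - 2a) p∘(z∘y) = (1 - 2a) b (z∘y), and 1 - 2a is 1 or -1. *)
Lemma peirce_mul p y z a b : jidempotent p -> (a == 0) || (a == 1) ->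
  p ∘ z = a *: z -> p ∘ y = b *: y -> p ∘ (z ∘ y) = b *: (z ∘ y).
Proof.
move=> pp ha hz hy; have := jordan_linearized p y z.
rewrite pp hz hy !linE => H.
by case/orP: ha H => /eqP -> H; jlra H.
Qed.

Lemma peirce_sq_half p z : jidempotent p -> p ∘ z = 2^-1 *: z ->
  p ∘ (p ∘ (z ∘ z)) = p ∘ (z ∘ z).
Proof.
move=> pp hz; have := jordan_linearized z p p.
rewrite pp [(z ∘ z) ∘ p]jmulC [z ∘ p]jmulC hz !linE [z ∘ p]jmulC hz !linE => H.
jlra H.
Qed.

(** By [peirce_mul] used both ways, the product lies in the eigenspaces of [p] for 0 and for 1 at
    once. *)
Lemma peirce10 p z y : jidempotent p -> p ∘ z = z -> p ∘ y = 0 -> z ∘ y = 0.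
Proof.
move=> pp hz hy.
have h1 : p ∘ (z ∘ y) = 0 *: (z ∘ y).
  by apply: (@peirce_mul p y z 1) => //; rewrite ?eqxx ?orbT // ?scale1r ?scale0r.
have h2 : p ∘ (y ∘ z) = 1 *: (y ∘ z).
  by apply: (@peirce_mul p z y 0); rewrite ?eqxx // ?scale1r ?scale0r.
by rewrite [z ∘ y]jmulC in h1 *; rewrite -[y ∘ z]scale1r -h2 h1 scale0r.
Qed.

(** Multiplying the relation by [p] once and twice gives a Vandermonde system with nodes 1, 1/2,
    0. *)
Lemma peirce_indep p x y z : p ∘ x = x -> p ∘ y = 2^-1 *: y -> p ∘ z = 0 ->
  x + y + z = 0 -> [/\ x = 0, y = 0 & z = 0].
Proof.
move=> hx hy hz h0.
have h1 : p ∘ (x + y + z) = 0 by rewrite h0 linE.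
have h2 : p ∘ (p ∘ (x + y + z)) = 0 by rewrite h1 linE.
rewrite !linE hx hy hz !linE ?hx ?hy ?hz ?linE in h1 h2.
split; jlra h0 h1 h2.
Qed.

(** Lagrange polynomials for the nodes 1, 1/2, 0 in multiplication by [p]; for an idempotent [p]
    they are the Peirce projections, and [peirce1 p] is the quadratic representation of [p]. *)
Definition peirce1 p x := 2 *: (p ∘ (p ∘ x)) - p ∘ x.
Definition peirceh p x := 4 *: (p ∘ x - p ∘ (p ∘ x)).
Definition peirce0 p x := x - 3 *: (p ∘ x) + 2 *: (p ∘ (p ∘ x)).

Lemma peirce_sum p x : x = peirce1 p x + peirceh p x + peirce0 p x.
Proof. rewrite /peirce1 /peirceh /peirce0; jlin. Qed.

Lemma peirce1P p x : jidempotent p -> p ∘ peirce1 p x = peirce1 p x.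
Proof.
move=> pp; have := peirce_cubic x pp; rewrite /peirce1 => H.
jlra H.
Qed.

Lemma peircehP p x : jidempotent p -> p ∘ peirceh p x = 2^-1 *: peirceh p x.
Proof.
move=> pp; have := peirce_cubic x pp; rewrite /peirceh => H.
jlra H.
Qed.

Lemma peirce0P p x : jidempotent p -> p ∘ peirce0 p x = 0.
Proof.
move=> pp; have := peirce_cubic x pp; rewrite /peirce0 => H.
jlra H.
Qed.

End PeirceIdempotent.

(** * Stretching along an idempotent *)

Section Stretch.
Context {R : realType} {V : euclideanJordanAlgebra R}.
Implicit Types (c p x y z w : V) (a b s t u : R).

(* The quadratic representation of [jone V + (u - 1) *: p]. *)
Definition stretch p u x :=
  x + (2 * (u - 1)) *: (p ∘ x) + ((u - 1) ^+ 2) *: (2 *: (p ∘ (p ∘ x)) - p ∘ x).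

Lemma stretchE p u x :
  stretch p u x = u ^+ 2 *: peirce1 p x + u *: peirceh p x + peirce0 p x.
Proof. rewrite /stretch /peirce1 /peirceh /peirce0; jlin. Qed.

(** The hypothesis on [s] says that the quadratic representation of [c] maps [p] to [s *: c], as
    happens for every primitive [c]. The Peirce spaces of [p] being independent, this equation and
    c∘c = c split into three each, and the six are solved for the products. *)
Lemma peirce_primitive p c s : jidempotent p -> jidempotent c ->
  2 *: (c ∘ (c ∘ p)) - c ∘ p = s *: c ->
  let x := peirce1 p c in let y := peirceh p c in let z := peirce0 p c in
  [/\ x ∘ x = s *: x, z ∘ z = (1 - s) *: z,
      2 *: (x ∘ y) = s *: y, 2 *: (z ∘ y) = (1 - s) *: y
    & y ∘ y = (1 - s) *: x + s *: z].
Proof.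
move=> pp cc hs x y z.
have px : p ∘ x = x by apply: peirce1P.
have py : p ∘ y = 2^-1 *: y by apply: peircehP.
have pz : p ∘ z = 0 by apply: peirce0P.
have ec : c = x + y + z by apply: peirce_sum.
have xz : x ∘ z = 0 by apply: (peirce10 pp).
have pxx : p ∘ (x ∘ x) = x ∘ x.
  by rewrite -[RHS]scale1r; apply: (@peirce_mul _ _ _ _ _ 1); rewrite ?scale1r // eqxx orbT.
have pzz : p ∘ (z ∘ z) = 0.
  by rewrite -[RHS](scale0r (z ∘ z)); apply: (@peirce_mul _ _ _ _ _ 0); rewrite ?scale0r // eqxx.
have pxy : p ∘ (x ∘ y) = 2^-1 *: (x ∘ y).
  by apply: (@peirce_mul _ _ _ _ _ 1); rewrite ?scale1r // eqxx orbT.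
have pzy : p ∘ (z ∘ y) = 2^-1 *: (z ∘ y).
  by apply: (@peirce_mul _ _ _ _ _ 0); rewrite ?scale0r // eqxx.
(* The components of [y ∘ y] in the 1-space and the 0-space of [p]; by [peirce_sq_half] there is no
   other. *)
set v1 := p ∘ (y ∘ y); set v0 := y ∘ y - v1.
have pv1 : p ∘ v1 = v1 by apply: peirce_sq_half.
have pv0 : p ∘ v0 = 0 by rewrite /v0 jmulDr jmulNr pv1; exact: (subrr v1).
have ev : y ∘ y = v1 + v0 by rewrite /v0 addrC subrK.
clearbody v1 v0 x y z.
have ecc : c ∘ c = x ∘ x + v1 + (2 *: (x ∘ y) + 2 *: (z ∘ y)) + (z ∘ z + v0).
  rewrite ec !linE [z ∘ x]jmulC [y ∘ x]jmulC [y ∘ z]jmulC xz ev; jlin.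
have cp : c ∘ p = x + 2^-1 *: y by rewrite ec jmulC !linE px py pz addr0.
have ccp : c ∘ (c ∘ p) = x ∘ x + 2^-1 *: v1 + (3 / 2 *: (x ∘ y) + 2^-1 *: (z ∘ y)) + 2^-1 *: v0.
  rewrite cp ec !linE [z ∘ x]jmulC [y ∘ x]jmulC xz ev; jlin.
have [e1 eh e0] : [/\ x ∘ x + v1 - x = 0, 2 *: (x ∘ y) + 2 *: (z ∘ y) - y = 0 & z ∘ z + v0 - z = 0].
  apply: (@peirce_indep _ _ p).
  - by rewrite !linE pxx pv1 px.
  - by rewrite !linE pxy pzy py; jlin.
  - by rewrite !linE pzz pv0 pz; jlin.
  - by move: cc; rewrite /jidempotent ecc ec => cc; jlra cc.
have [f1 fh f0] : [/\ 2 *: (x ∘ x) + v1 - x - s *: x = 0,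
    3 *: (x ∘ y) + z ∘ y - 2^-1 *: y - s *: y = 0
    & v0 - s *: z = 0].
  apply: (@peirce_indep _ _ p).
  - by rewrite !linE pxx pv1 px.
  - by rewrite !linE pxy pzy py; jlin.
  - by rewrite !linE pv0 pz; jlin.
  - by move: hs; rewrite ccp cp ec => hs; jlra hs.
split; first by jlra e1 f1.
- by jlra e0 f0.
- by jlra eh fh.
- by jlra eh fh.
- by rewrite ev; jlra e1 f1 f0.
Qed.

Lemma stretch_sq p c s u : jidempotent p -> jidempotent c ->
  2 *: (c ∘ (c ∘ p)) - c ∘ p = s *: c ->
  stretch p u c ∘ stretch p u c = (u ^+ 2 * s + (1 - s)) *: stretch p u c.
Proof.
move=> pp cc /(peirce_primitive pp cc) /=.
have := peirce10 pp (peirce1P c pp) (peirce0P c pp).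
rewrite !stretchE.
move: (peirce1 p c) (peirceh p c) (peirce0 p c) => x y z xz [xx zz xy zy yy].
rewrite !linE [z ∘ x]jmulC [y ∘ x]jmulC [y ∘ z]jmulC xz xx zz yy.
apply: dot_inj => w; jpair w xy; jpair w zy; rewrite !linE.
have -> : ⟨x ∘ y, w⟩ = 2^-1 * (s * ⟨y, w⟩) by lra.
have -> : ⟨z ∘ y, w⟩ = 2^-1 * ((1 - s) * ⟨y, w⟩) by lra.
by field.
Qed.

End Stretch.

(** * Powers and the spectral theorem *)

Section RealPolynomial.
Context {R : rcfType}.
Implicit Types (p r : {poly R}) (a b : R).

(** A complex root a + ib gives a linear factor if b = 0, and otherwise the real quadratic with
    roots a + ib and a - ib. *)
Lemma rcf_factor p : (1 < size p)%N ->
  (exists a r, p = r * ('X - a%:P)) \/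
  (exists a b r, b != 0 /\ p = r * (('X - a%:P) ^+ 2 + (b ^+ 2)%:P)).
Proof.
move=> sp; pose f := real_complex R.
have [z] : exists z, root (map_poly f p) z.
  by apply/closed_rootP; rewrite size_map_poly neq_ltn sp orbT.
case: z => a b rz; have [b0|bn0] := eqVneq b 0.
  left; exists a; have /factor_theorem[r ->] : root p a; last by exists r.
  rewrite -(fmorph_root f); move: rz; rewrite b0; exact.
right; exists a, b; set d := _ + _.
pose z := Complex a b.
have sd : size d = 3%N.
  rewrite /d size_polyDl ?size_exp_XsubC // (leq_ltn_trans (size_polyC_leq1 _)) //.
have dz : (map_poly f d).[z] = 0.
  rewrite /d rmorphD rmorphXn rmorphB /= map_polyX !map_polyC /= !hornerE /z.
  rewrite /f /= expr2; apply/eqP; rewrite eq_complex /=; apply/andP; split; apply/eqP; ring.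
exists (p %/ d); split => //.
(* The remainder has degree at most 1 and vanishes at [z]; as [b] is nonzero, imaginary and real
   parts force both coefficients to be 0. *)
suff m0 : p %% d = 0 by rewrite {1}(divp_eq p d) m0 addr0.
have sm : (size (p %% d)%R <= 2)%N.
  by rewrite -ltnS -sd ltn_modp -size_poly_gt0 sd.
have mE : p %% d = (p %% d)`_1 *: 'X + ((p %% d)`_0)%:P.
  apply/polyP => i; rewrite coefD coefZ coefX coefC.
  case: i => [|[|i]] /=; rewrite ?mulr0 ?mulr1 ?add0r ?addr0 //.
  by rewrite nth_default // (leq_trans sm).
have : (map_poly f (p %% d)).[z] = 0.
  move/rootP: rz; rewrite {1}(divp_eq p d) rmorphD rmorphM hornerD hornerM dz mulr0 add0r.
  by [].
rewrite mE rmorphD /= map_polyC map_polyZ /= map_polyX hornerD hornerZ hornerX hornerC.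
move=> /eqP; rewrite eq_complex /= !mul0r !addr0 subr0 => /andP[/eqP h0 /eqP h1].
have c1 : (p %% d)`_1 = 0.
  by apply/eqP; move/eqP: h1; rewrite mulf_eq0 (negPf bn0) orbF.
by rewrite c1 mul0r add0r in h0; rewrite c1 h0 scale0r addr0.
Qed.

End RealPolynomial.

(** Multiplication by [z] preserves each Peirce space of [p], on which [p] acts as a scalar. *)
Lemma peirce_comm {R : realType} {V : euclideanJordanAlgebra R} (p z y : V) (a : R) :
  jidempotent p -> (a == 0) || (a == 1) -> p ∘ z = a *: z ->
  p ∘ (z ∘ y) = z ∘ (p ∘ y).
Proof.
move=> pp ha hz; have yE := peirce_sum p y.
have h1 : p ∘ peirce1 p y = 1 *: peirce1 p y by rewrite scale1r peirce1P.
have h0 : p ∘ peirce0 p y = 0 *: peirce0 p y by rewrite scale0r peirce0P.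
have hh := peircehP y pp.
move: yE h1 hh h0; move: (peirce1 p y) (peirceh p y) (peirce0 p y).
move=> y1 yh y0 -> h1 hh h0; rewrite !jmulDr h1 hh h0 !jmulZr.
by rewrite (peirce_mul pp ha hz h1) (peirce_mul pp ha hz hh) (peirce_mul pp ha hz h0).
Qed.

(** * Polynomials in one element of the 1-space of an idempotent *)

Section Power.
Context {R : realType} {V : euclideanJordanAlgebra R}.
Variables (c x : V).
Hypotheses (cc : jidempotent c) (cx : c ∘ x = x).
Implicit Types (p q r : {poly R}) (a b : R).

(** The 1-space of [c] has unit [c], so exponent 0 gives [c]. *)
Definition jpow i := iter i (jmul V x) c.

Definition jhorner p := \sum_(i < size p) p`_i *: jpow i.

Lemma jpow_unit i : c ∘ jpow i = jpow i.
Proof.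
elim: i => //= i IH.
by rewrite (@peirce_comm _ _ c _ _ 1) ?IH // ?eqxx ?orbT // scale1r.
Qed.

Lemma jpow_sq i : (x ∘ x) ∘ jpow i = jpow i.+2.
Proof.
elim: i => [|i IH].
  by rewrite jmulC -[RHS](jpow_unit 2) /= [x ∘ c]jmulC cx.
  rewrite -[in RHS](erefl : x ∘ jpow i.+2 = jpow i.+3) -IH.
by rewrite jordan_identity.
Qed.

(** Two consecutive exponents are carried through the induction: the linearized identity expresses
    multiplication by x^(i+2) through those by x, x^2, x^i and x^(i+1), all commuting with
    multiplication by x. *)
Lemma jpow_comm i y : x ∘ (jpow i ∘ y) = jpow i ∘ (x ∘ y).
Proof.
suff: (forall y, x ∘ (jpow i ∘ y) = jpow i ∘ (x ∘ y)) /\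
      (forall y, x ∘ (jpow i.+1 ∘ y) = jpow i.+1 ∘ (x ∘ y)) by case.
elim: i {y} => [|i [IH1 IH2]].
  split=> y /=; last by rewrite [x ∘ c]jmulC cx.
  by rewrite (@peirce_comm _ _ c _ _ 1) // ?eqxx ?orbT // scale1r.
split=> // y.
have E z : jpow i.+2 ∘ z = 2 *: (jpow i.+1 ∘ (x ∘ z)) + (x ∘ x) ∘ (jpow i ∘ z)
    - 2 *: (x ∘ (jpow i ∘ (x ∘ z))).
  have := jordan_linearized x (jpow i) z.
  rewrite jpow_sq [(x ∘ z) ∘ (x ∘ _)]jmulC [z ∘ jpow i.+2]jmulC.
  rewrite [z ∘ jpow i]jmulC [_ ∘ z ∘ jpow i]jmulC -/(jpow i.+1).
  by move=> /(canLR (addrK _)) <-.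
by rewrite !E !linE !IH1 !IH2 jordan_identity !IH1.
Qed.

Lemma jhorner_wide n p : (size p <= n)%N -> jhorner p = \sum_(i < n) p`_i *: jpow i.
Proof.
move=> pn; rewrite /jhorner (big_ord_widen n (fun i => p`_i *: jpow i) pn) big_mkcond /=.
by apply: eq_bigr => i _; case: ltnP => // h; rewrite nth_default // scale0r.
Qed.

Lemma jhornerD p q : jhorner (p + q) = jhorner p + jhorner q.
Proof.
pose n := maxn (size p) (size q).
rewrite (@jhorner_wide n p) ?leq_maxl // (@jhorner_wide n q) ?leq_maxr //.
rewrite (@jhorner_wide n) ?size_polyD // -big_split /=.
by apply: eq_bigr => i _; rewrite coefD scalerDl.
Qed.

Lemma jhornerZ a p : jhorner (a *: p) = a *: jhorner p.
Proof.
rewrite (@jhorner_wide (size p)) ?size_scale_leq // scaler_sumr.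
by apply: eq_bigr => i _; rewrite coefZ scalerA.
Qed.

Lemma jhorner0 : jhorner 0 = 0.
Proof. by rewrite /jhorner size_poly0 big_ord0. Qed.

Lemma jhornerC a : jhorner a%:P = a *: c.
Proof.
by rewrite (@jhorner_wide 1) ?size_polyC_leq1 // big_ord1 coefC.
Qed.

Lemma jhornerMX p : jhorner (p * 'X) = x ∘ jhorner p.
Proof.
rewrite (@jhorner_wide (size p).+1); last first.
  by have [->|/size_mulX->] := eqVneq p 0; rewrite // mul0r size_poly0.
rewrite big_ord_recl coefMX scale0r add0r jmul_sumr.
by apply: eq_bigr => i _; rewrite coefMX /= jmulZr.
Qed.

Lemma jhorner_unit p : c ∘ jhorner p = jhorner p.
Proof.
by rewrite jmul_sumr; apply: eq_bigr => i _; rewrite jmulZr jpow_unit.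
Qed.

Lemma jhorner_comm p y : x ∘ (jhorner p ∘ y) = jhorner p ∘ (x ∘ y).
Proof.
rewrite /jhorner !jmul_suml jmul_sumr.
by apply: eq_bigr => i _; rewrite !jmulZl jmulZr jpow_comm.
Qed.

(** Power associativity, by induction on [q]; [jhorner_comm] moves each new factor [x] outside. *)
Lemma jhornerM p q : jhorner (p * q) = jhorner p ∘ jhorner q.
Proof.
elim/poly_ind: q => [|q a IH]; first by rewrite mulr0 jhorner0 jmul0r.
rewrite mulrDr mulrA !jhornerD !jhornerMX IH jhorner_comm jhornerC.
rewrite [p * _]mulrC mul_polyC jhornerZ jmulDr jmulZr.
by rewrite [jhorner p ∘ c]jmulC jhorner_unit.
Qed.

Lemma jhorner_annihilator : exists2 p, p != 0 & jhorner p = 0.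
Proof.
(* One power more than the dimension, so the powers are linearly dependent. *)
pose n := (\dim {:V}).+1.
pose X := [tuple jpow i | i < n].
have : ~~ free X.
  apply/negP => /eqP h; have := dimvS (subvf <<X>>%VS).
  by rewrite h size_tuple ltnn.
move/freeP => H.
have [k [k0 [i ki]]] : exists k : 'I_n -> R,
    \sum_(i < n) k i *: X`_i = 0 /\ exists i, k i != 0.
  apply: contrapT => h; apply: H => k k0 i; apply: contrapT => /eqP ki.
  by apply: h; exists k; split => //; exists i.
exists (\poly_(i < n) k (inord i)).
  apply: contraNneq ki => /(congr1 (fun p : {poly R} => p`_i)).
  by rewrite coef_poly ltn_ord coef0 inord_val => ->.
rewrite (@jhorner_wide n) ?size_poly //; apply: etrans k0; apply: eq_bigr => j _.
by rewrite coef_poly ltn_ord inord_val -tnth_nth tnth_mktuple.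
Qed.

(** Associativity of the form turns ⟨y, y⟩ = ⟨y ∘ c, y⟩ into ⟨c, y ∘ y⟩. *)
Lemma jmul_self_eq0 y : c ∘ y = y -> y ∘ y = 0 -> y = 0.
Proof. by move=> cy yy; apply: dot_eq0; rewrite -{1}cy jmulC dot_mulA yy dot0r. Qed.

Lemma idempotent_eigenvector : c != 0 ->
  exists (q : V) a, [/\ q != 0, jidempotent q, c ∘ q = q & x ∘ q = a *: q].
Proof.
move=> c0; have [p] := jhorner_annihilator.
have [m] := ubnP (size p); elim: m p => // m IH p sm pn0 hp.
have sp : (1 < size p)%N.
  rewrite ltnNge; apply/negP => /size1_polyC pC.
  move: hp pn0; rewrite pC jhornerC => /eqP.
  by rewrite scaler_eq0 (negPf c0) orbF polyC_eq0 => /eqP->; rewrite eqxx.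
have [[a [r pE]]|[a [b [r [b0 pE]]]]] := rcf_factor sp.
- have r0 : r != 0 by apply: contraNneq pn0 => r0; rewrite pE r0 mul0r.
  have [hr|hr] := eqVneq (jhorner r) 0.
    by apply: IH hr => //; move: sm; rewrite pE size_Mmonic ?monicXsubC // size_XsubC addn2.
  have xr : x ∘ jhorner r = a *: jhorner r.
    move: hp; rewrite pE mulrBr jhornerD -mulrN -polyCN [r * _%:P]mulrC mul_polyC.
    by rewrite jhornerMX jhornerZ scaleNr => /eqP; rewrite subr_eq0 => /eqP.
  have ev p' : jhorner p' ∘ jhorner r = p'.[a] *: jhorner r.
    elim/poly_ind: p' => [|q b IHq]; first by rewrite jhorner0 jmul0l horner0 scale0r.
    rewrite jhornerD jhornerMX jhornerC jmulDl jmulZl jhorner_unit hornerMXaddC scalerDl.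
    congr (_ + _); rewrite jmulC -jhorner_comm jmulC.
    by rewrite [_ ∘ jhorner q]jmulC IHq jmulC jmulZr xr scalerA.
  have ra : r.[a] != 0.
    apply: contraNneq hr => ra; apply/eqP/jmul_self_eq0; first exact: jhorner_unit.
    by rewrite ev ra scale0r.
  (* By [ev], r(x) ∘ r(x) = r(a) r(x), so dividing by r(a) gives an idempotent. *)
  exists (r.[a]^-1 *: jhorner r), a; split.
  + by rewrite scaler_eq0 invr_eq0 (negPf ra).
  + by rewrite /jidempotent !linE ev !scalerA -mulrA mulVf // mulr1.
  + by rewrite linE jhorner_unit.
  + by rewrite linE xr !scalerA mulrC.
- have r0 : r != 0 by apply: contraNneq pn0 => r0; rewrite pE r0 mul0r.
  have sd : size (('X - a%:P) ^+ 2 + (b ^+ 2)%:P) = 3%N.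
    by rewrite size_polyDl ?size_exp_XsubC // (leq_ltn_trans (size_polyC_leq1 _)).
  apply: (IH r) => //.
    move: sm; rewrite pE size_mul // -?size_poly_gt0 ?sd //.
    by rewrite addn3 /= ltnS => /ltnW.
  apply: dot_eq0.
  (* Pairing p(x) = 0 with r(x) gives |(x - a) r(x)|^2 + b^2 |r(x)|^2 = 0. *)
  pose y := jhorner (r * ('X - a%:P)).
  have : ⟨jhorner p, jhorner r⟩ = ⟨y, y⟩ + b ^+ 2 * ⟨jhorner r, jhorner r⟩.
    rewrite pE mulrDr jhornerD dotDl [r * _%:P]mulrC mul_polyC jhornerZ dotZl.
    congr (_ + _); rewrite expr2 mulrA [_ * ('X - _)]mulrC /y.
    rewrite jhornerM dot_mulA -jhornerM [_ * r]mulrC.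
    by [].
  rewrite hp dot0l => h.
  have := dot_ge0 y; have := dot_ge0 (jhorner r).
  have : 0 < b ^+ 2 by rewrite exprn_even_gt0.
  nra.
Qed.

End Power.

(** * The spectral theorem in the 1-space of an idempotent *)

Section Spectral.
Context {R : realType} {V : euclideanJordanAlgebra R}.
Implicit Types (c p q d x y z w : V) (a b u : R).

Lemma mem_leigenspace_jmul c y a :
  (y \in passmx.leigenspace (linfun (jmul V c)) a) = (c ∘ y == a *: y).
Proof.
rewrite memv_ker; rewrite !lfunE /= !lfunE /= !lfunE /= lfunE /=.
by rewrite subr_eq0.
Qed.

Lemma idempotentB c q : jidempotent c -> jidempotent q -> c ∘ q = q ->
  jidempotent (c - q) /\ q ∘ (c - q) = 0.
Proof.
by move=> cc qq cq; split; rewrite /jidempotent !linE [q ∘ c]jmulC cq ?cc qq; jlin.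
Qed.

Lemma idempotent_face c q y : jidempotent c -> jidempotent q -> c ∘ q = q ->
  q ∘ y = y -> c ∘ y = y.
Proof.
move=> cc qq cq qy; have [dd qd] := idempotentB cc qq cq.
have dy : y ∘ (c - q) = 0 by apply: (peirce10 qq).
by rewrite -(subrK q c) jmulDl [_ ∘ y]jmulC dy add0r.
Qed.

Lemma idempotent_face0 c q y z : jidempotent c -> jidempotent q -> c ∘ q = q ->
  q ∘ y = y -> (c - q) ∘ z = z -> y ∘ z = 0.
Proof.
move=> cc qq cq qy dz; have [dd qd] := idempotentB cc qq cq.
apply: (peirce10 qq) => //.
by rewrite jmulC; apply: (peirce10 dd) => //; rewrite jmulC.
Qed.

Lemma idempotent_splitD c p q : jidempotent c -> jidempotent p -> jidempotent q ->
  c = p + q -> c ∘ p = p.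
Proof.
rewrite /jidempotent => + pp qq cE; rewrite cE !linE pp qq [q ∘ p]jmulC => cc.
by jlra cc.
Qed.

(** Equal dimensions would put [c] in the 1-space of [q], making them equal. This dimension is the
    measure of the spectral induction. *)
Lemma dim_face_lt c q : jidempotent c -> jidempotent q -> c ∘ q = q -> q != c ->
  (\dim (passmx.leigenspace (linfun (jmul V q)) 1) <
   \dim (passmx.leigenspace (linfun (jmul V c)) 1))%N.
Proof.
move=> cc qq cq; rewrite ltnNge; apply: contra => h.
have sub : (passmx.leigenspace (linfun (jmul V q)) 1 <=
            passmx.leigenspace (linfun (jmul V c)) 1)%VS.
  apply/subvP => y; rewrite !mem_leigenspace_jmul !scale1r => /eqP qy.
  by apply/eqP; apply: idempotent_face qy.
have /eqP E : passmx.leigenspace (linfun (jmul V q)) 1 ==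
              passmx.leigenspace (linfun (jmul V c)) 1 by rewrite eqEdim sub h.
have : c \in passmx.leigenspace (linfun (jmul V c)) 1.
  by rewrite mem_leigenspace_jmul scale1r cc.
by rewrite -E mem_leigenspace_jmul scale1r jmulC cq.
Qed.

(** The idempotent eigenvector [q] of [x] splits [c] as q + (c - q), so primitivity leaves q = c,
    and then x = x∘c is a multiple of [c]. *)
Lemma primitive_line c x : jprimitive c -> c ∘ x = x -> exists a, x = a *: c.
Proof.
move=> [/eqP c0 cc prim] cx.
have [q [a [q0 qq cq xq]]] := idempotent_eigenvector cc cx c0.
have [qc|/eqP qc] := eqVneq q c.
  by exists a; rewrite -{}qc in xq cx *; rewrite -xq jmulC cx.
case: prim; exists q, (c - q); have [dd _] := idempotentB cc qq cq.
split=> //; first exact/eqP.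
  by move=> /subr0_eq /esym.
by rewrite addrC subrK.
Qed.

Definition orthogonal_family (s : seq (R * V)) :=
  pairwise (fun f g => f.2 ∘ g.2 == 0) s.

Lemma orthogonal_family_unit s f : (forall g, g \in s -> jidempotent g.2) ->
  orthogonal_family s -> f \in s -> (\sum_(g <- s) g.2) ∘ f.2 = f.2.
Proof.
elim: s => // g s IH idem; rewrite /orthogonal_family pairwise_cons => /andP[/allP gs os].
have idems h : h \in s -> jidempotent h.2 by move=> hs; apply: idem; rewrite inE hs orbT.
rewrite inE big_cons jmulDl => /orP[/eqP->|fs].
  rewrite idem ?mem_head // jmul_suml big_seq big1 ?addr0 // => h hs.
  by rewrite jmulC; apply/eqP/gs.
by rewrite IH // (eqP (gs _ fs)) add0r.
Qed.

Definition spectral_on c x (s : seq (R * V)) :=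
  [/\ forall f, f \in s -> jprimitive f.2, orthogonal_family s,
      \sum_(f <- s) f.2 = c & x = \sum_(f <- s) f.1 *: f.2].

Lemma spectral_on_cat c q x y s t : jidempotent c -> jidempotent q -> c ∘ q = q ->
  spectral_on q x s -> spectral_on (c - q) y t -> spectral_on c (x + y) (s ++ t).
Proof.
move=> cc qq cq [ps os es xs] [pt ot et yt]; split.
- by move=> f; rewrite mem_cat => /orP[/ps|/pt].
- rewrite /orthogonal_family pairwise_cat.
  apply/and3P; split=> //; apply/allrelP => f g fs gt; apply/eqP.
  apply: (idempotent_face0 cc qq cq).
    by rewrite -es orthogonal_family_unit // => h /ps[].
  by rewrite -et orthogonal_family_unit // => h /pt[].
- by rewrite big_cat /= es et addrC subrK.
- by rewrite big_cat /= -xs -yt.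
Qed.

(** Induction on the dimension of the 1-space of [c]: a proper idempotent compatible with [x] splits
    the problem into two smaller ones. It comes from an eigenvector of [x] or, when [x] is a
    multiple of [c], from a failure of primitivity of [c]. *)
Theorem spectral_decomposition c x : jidempotent c -> c ∘ x = x ->
  exists s, spectral_on c x s.
Proof.
have [m] := ubnP (\dim (passmx.leigenspace (linfun (jmul V c)) 1)).
elim: m c x => // m IH c x; rewrite ltnS => dm cc cx.
have [c0|c0] := eqVneq c 0.
  exists [::]; split=> //; rewrite ?big_nil //.
  by rewrite -cx c0 jmul0l.
have split_ex q y : jidempotent q -> q != 0 -> q != c -> c ∘ q = q -> q ∘ y = y ->
    (c - q) ∘ (x - y) = x - y -> exists s, spectral_on c x s.
  move=> qq q0 qc cq qy dy; have [dd qd] := idempotentB cc qq cq.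
  have [|s hs] := IH q y _ qq qy; first exact: leq_trans (dim_face_lt _ _ _ _) dm.
  have [|t ht] := IH (c - q) (x - y) _ dd dy.
    apply: leq_trans (dim_face_lt _ _ _ _) dm => //.
      by rewrite !linE cc cq.
    by apply: contra_neq q0 => /(canRL (addrNK _)) /esym/eqP; rewrite -subr_eq0 addrC addKr => /eqP.
  exists (s ++ t); rewrite -(subrK y x) addrC.
  exact: (spectral_on_cat cc qq cq hs ht).
have [q [a [q0 qq cq xq]]] := idempotent_eigenvector cc cx c0.
have [qc|qc] := eqVneq q c; last first.
  apply: (split_ex q (a *: q)) => //; first by rewrite linE qq.
  by rewrite !linE cx cq [q ∘ x]jmulC xq qq; jlin.
have xE : x = a *: c by rewrite -qc in cx *; rewrite -xq jmulC cx.
have [prim|nprim] := pselect (jprimitive c).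
  exists [:: (a, c)]; split; rewrite ?big_seq1 //.
  by move=> f; rewrite inE => /eqP->.
have [p [r [p0 r0 pp rr cE]]] : exists p r : V,
    [/\ p <> 0, r <> 0, jidempotent p, jidempotent r & c = p + r].
  by apply: contrapT => h; apply: nprim; split=> //; apply/eqP.
have cp := idempotent_splitD cc pp rr cE.
apply: (split_ex p (a *: p)) => //.
- exact/eqP.
- apply/eqP => pc; apply: r0; move: cE; rewrite pc -{1}[c]addr0 => /addrI ->.
  by [].
- by rewrite linE pp.
- have [dd _] := idempotentB cc pp cp.
  by rewrite xE -scalerBr jmulZr dd.
Qed.

End Spectral.

(** * The symmetric cone and primitive idempotents *)

Section Cone.
Context {R : realType} {V : euclideanJordanAlgebra R}.
Implicit Types (c p q d x y z w : V) (a b u : R).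

Lemma idempotent_dot_ge0 p q : jidempotent p -> jidempotent q -> 0 <= ⟨p, q⟩.
Proof.
move=> pp qq; set y := q ∘ p.
(* The eigenvalues 0, 1/2, 1 of multiplication by q are roots of
   [t = t ^ 2 + 4 * (t - t ^ 2) ^ 2]. *)
suff -> : ⟨p, q⟩ = ⟨y, y⟩ + 4 * ⟨y - q ∘ y, y - q ∘ y⟩.
  by rewrite addr_ge0 ?mulr_ge0 ?dot_ge0.
have yE : ⟨p, q⟩ = ⟨p, y⟩ by rewrite -{1}pp dot_mulA /y jmulC.
have e2 : ⟨y, y⟩ = ⟨p, q ∘ y⟩ by rewrite {1}/y dot_mulA.
have e3 : ⟨y, q ∘ y⟩ = ⟨p, q ∘ (q ∘ y)⟩ by rewrite {1}/y dot_mulA.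
have e4 : ⟨q ∘ y, q ∘ y⟩ = ⟨p, q ∘ (q ∘ (q ∘ y))⟩ by rewrite dot_mulA {1}/y dot_mulA.
have c1 := peirce_cubic p qq; have c2 := peirce_cubic y qq.
move: c1 c2; rewrite -/y => c1 c2.
rewrite yE !linE !dotDr !dotNr [⟨q ∘ y, y⟩]dotC e2 e3 e4.
move: c1 c2 => /(congr1 (fun v => ⟨v, p⟩)) c1 /(congr1 (fun v => ⟨v, p⟩)) c2.
rewrite !linE in c1 c2; rewrite ![⟨p, _⟩]dotC; lra.
Qed.

(** By [primitive_line] the left side is a multiple of [c]; pairing with [c] yields the
    coefficient. *)
Lemma primitive_compression c x : jprimitive c ->
  2 *: (c ∘ (c ∘ x)) - c ∘ x = (⟨x, c⟩ / ⟨c, c⟩) *: c.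
Proof.
move=> prim; have [/eqP c0 cc _] := prim.
have [a h] := primitive_line prim (peirce1P x cc).
rewrite -/(peirce1 c x) h; congr (_ *: _).
have cp : ⟨c, c⟩ != 0 by rewrite gt_eqF ?dot_gt0.
apply: (canRL (mulfK cp)); rewrite -dotZl -h /peirce1 !linE !dot_mulA !cc.
lra.
Qed.

(** The symmetric cone, described dually by pairings with primitive idempotents. *)
Definition jpos x := forall d, jprimitive d -> 0 <= ⟨x, d⟩.

Lemma idempotent_pos q : jidempotent q -> jpos q.
Proof. by move=> qq d [_ dd _]; apply: idempotent_dot_ge0. Qed.

Lemma jpos_idempotent x q : jpos x -> jidempotent q -> 0 <= ⟨x, q⟩.
Proof.
move=> px qq; have [s [prim _ <- _]] := spectral_decomposition qq qq.
by rewrite dot_sumr big_seq sumr_ge0 // => f /prim/px.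
Qed.

Lemma stretch_adj p u x y : ⟨stretch p u x, y⟩ = ⟨x, stretch p u y⟩.
Proof. by rewrite /stretch [RHS]dotC !linE !dot_mulA ![⟨y, _⟩]dotC !dot_mulA; ring. Qed.

(** For z = [stretch p u c], [stretch_sq] gives z∘z = t z with t = u^2 s + 1 - s. As 0 <= s <= 1, t
    is nonnegative, so z is t times an idempotent, or 0 when t = 0. *)
Lemma jpos_primitive_stretch p u c x : jidempotent p -> jprimitive c -> jpos x ->
  0 <= ⟨x, stretch p u c⟩.
Proof.
move=> pp prim px; have [/eqP c0 cc _] := prim.
have zz := stretch_sq u pp cc (primitive_compression p prim).
set s := _ / _ in zz; set t := _ + _ in zz; set z := stretch p u c in zz *.
have cp : 0 < ⟨c, c⟩ by rewrite dot_gt0.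
have s0 : 0 <= s by rewrite divr_ge0 ?dot_ge0 ?idempotent_dot_ge0.
(* This is ⟨jone V - p, c⟩ >= 0 divided by ⟨c, c⟩. *)
have s1 : 0 <= 1 - s.
  rewrite /s subr_ge0 ler_pdivrMr // mul1r -subr_ge0.
  have ee : jidempotent (jone V) by rewrite /jidempotent jmul1x.
  have [dd _] := idempotentB ee pp (jmul1x p).
  have := idempotent_dot_ge0 dd cc; rewrite !linE.
  by rewrite -{1}cc dotC dot_mulA jmulx1.
have t0 : 0 <= t by rewrite addr_ge0 // mulr_ge0 // exprn_even_ge0.
have [te|tn] := eqVneq t 0.
  have -> : z = 0.
    apply: dot_eq0; rewrite -{1}[z]jmul1x jmulC dot_mulA zz te scale0r.
    exact: dot0r.
  by rewrite dot0r.
have -> : z = t *: (t^-1 *: z) by rewrite scalerA mulfV // scale1r.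
rewrite dotZr mulr_ge0 //; apply: jpos_idempotent => //.
by rewrite /jidempotent jmulZl jmulZr zz !scalerA -mulrA mulVf // mulr1.
Qed.

Lemma jpos_stretch p u x : jidempotent p -> jpos x -> jpos (stretch p u x).
Proof.
by move=> pp px d prim; rewrite stretch_adj; apply: jpos_primitive_stretch.
Qed.

(** The component of [c] in the 1-space of [d] is x = t d with t = ⟨c, d⟩ / ⟨d, d⟩, and x∘x = s x
    with s = ⟨c, d⟩ / ⟨c, c⟩ forces t = s. *)
Lemma primitive_norm c d : jprimitive c -> jprimitive d -> ⟨c, d⟩ != 0 ->
  ⟨c, c⟩ = ⟨d, d⟩.
Proof.
move=> pc pd cd; have [/eqP c0 cc _] := pc; have [/eqP d0 dd _] := pd.
have [h _ _ _ _] := peirce_primitive dd cc (primitive_compression d pc).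
move: h; rewrite /peirce1 (primitive_compression c pd) !linE dd !scalerA.
move=> /(congr1 (fun v => ⟨v, d⟩)); rewrite !dotZl [⟨d, c⟩]dotC.
have cp : ⟨c, c⟩ != 0 by rewrite gt_eqF ?dot_gt0.
have dp : ⟨d, d⟩ != 0 by rewrite gt_eqF ?dot_gt0.
move=> /(mulIf dp) /(mulIf (mulf_neq0 cd (invr_neq0 dp))) /(mulfI cd) /invr_inj.
by [].
Qed.

End Cone.

(** * Jordan frames and eigenvalues *)

Lemma perm_pairwise (T : eqType) (r : rel T) (s t : seq T) : symmetric r ->
  perm_eq s t -> pairwise r s -> pairwise r t.
Proof.
move=> symr; elim: t s => // x t IH s st ps.
have xs : x \in s by rewrite (perm_mem st) mem_head.
have rt : perm_eq (rem x s) t.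
  by rewrite -(perm_cons x) -(permPr st) perm_sym perm_to_rem.
rewrite pairwise_cons (IH (rem x s)) ?andbT //; last first.
  exact: subseq_pairwise (rem_subseq x s) ps.
rewrite -(perm_all _ rt); elim: s xs ps {IH st rt} => //= y s IH.
rewrite inE => /orP[/eqP->|xs] /andP[ys ps]; first by rewrite eqxx.
case: eqVneq => [<-//|_] /=; rewrite IH // andbT symr.
exact: (allP ys).
Qed.

Section Frame.
Context {R : realType} {V : euclideanJordanAlgebra R}.
Implicit Types (c p q d x y z w : V) (a b u : R).

Section OneFrame.
Variables (n : nat) (f : 'I_n -> V).
Hypothesis ff : jordan_frame f.

Lemma frame_primitive i : jprimitive (f i). Proof. by case: ff. Qed.

Lemma frame_idempotent i : jidempotent (f i).
Proof. by case: (frame_primitive i). Qed.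

Lemma frame_mul i j : i != j -> f i ∘ f j = 0. Proof. by case: ff => _ + _; apply. Qed.

Lemma frame_sum : \sum_i f i = jone V. Proof. by case: ff. Qed.

Lemma frame_dot i j : i != j -> ⟨f i, f j⟩ = 0.
Proof. by move=> ij; rewrite -(frame_idempotent i) dot_mulA frame_mul // dot0r. Qed.

Lemma frame_norm_gt0 i : 0 < ⟨f i, f i⟩.
Proof. by apply: dot_gt0; case: (frame_primitive i) => /eqP. Qed.

Lemma frame_dot1 i : ⟨f i, jone V⟩ = ⟨f i, f i⟩.
Proof. by rewrite -{1}(frame_idempotent i) dot_mulA jmulx1. Qed.

Lemma frame_comb_mul (l : 'I_n -> R) j : (\sum_i l i *: f i) ∘ f j = l j *: f j.
Proof.
rewrite jmul_suml (bigD1 j) //= jmulZl frame_idempotent big1 ?addr0 // => i ij.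
by rewrite jmulZl frame_mul // scaler0.
Qed.

Lemma frame_comb_dot (l : 'I_n -> R) j : ⟨\sum_i l i *: f i, f j⟩ = l j * ⟨f j, f j⟩.
Proof. by rewrite -{1}(frame_idempotent j) dotC dot_mulA jmulC frame_comb_mul dotZr. Qed.

End OneFrame.

(** Double counting of the weights ⟨f i, g j⟩ / ⟨f i, f i⟩, which sum to 1 for each [i]; by
    [primitive_norm] they are symmetric in the two frames. *)
Lemma frame_size m n (f : 'I_m -> V) (g : 'I_n -> V) :
  jordan_frame f -> jordan_frame g -> m = n.
Proof.
move=> ff fg; apply/eqP; rewrite -(eqr_nat R); apply/eqP.
have count k l (h : 'I_k -> V) (h' : 'I_l -> V) : jordan_frame h -> jordan_frame h' ->
    k%:R = \sum_i \sum_j ⟨h i, h' j⟩ / ⟨h i, h i⟩ :> R.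
  move=> fh fh'; rewrite (eq_bigr (fun=> 1)) ?sumr_const ?card_ord // => i _.
  rewrite -mulr_suml -dot_sumr (frame_sum fh') (frame_dot1 fh) mulfV //.
  by rewrite gt_eqF ?frame_norm_gt0.
rewrite (count _ _ f g) // (count _ _ g f) // exchange_big /=.
apply: eq_bigr => j _; apply: eq_bigr => i _; rewrite [⟨g j, f i⟩]dotC.
have [->|h] := eqVneq ⟨f i, g j⟩ 0; first by rewrite !mul0r.
by rewrite (primitive_norm (frame_primitive ff i) (frame_primitive fg j) h).
Qed.

Lemma sorted_spectral n x : has_rank V n ->
  exists l : n.-tuple R, sorted >=%R l /\
    exists f : 'I_n -> V, jordan_frame f /\ x = \sum_(i < n) tnth l i *: f i.
Proof.
case=> e fe.
have ee : jidempotent (jone V) by rewrite /jidempotent jmul1x.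
have [s0 [prim0 orth0 sum0 xE0]] := spectral_decomposition ee (jmul1x x).
pose s := sort (fun p q : R * V => q.1 <= p.1) s0.
have ps : perm_eq s0 s by rewrite perm_sym perm_sort.
have prim f : f \in s -> jprimitive f.2 by rewrite mem_sort; apply: prim0.
have orth : orthogonal_family s.
  by apply: perm_pairwise ps orth0 => p q; rewrite jmulC.
have sum : \sum_(f <- s) f.2 = jone V by rewrite -(perm_big _ ps).
have xE : x = \sum_(f <- s) f.1 *: f.2 by rewrite -(perm_big _ ps).
have srt : sorted (fun p q : R * V => q.1 <= p.1) s.
  by apply: sort_sorted => p q; apply: le_total.
clearbody s; pose f i := (tnth (in_tuple s) i).2.
have ff : jordan_frame f.
  split.
  - by move=> i; apply/prim/mem_tnth.
  - suff lt (i j : 'I_(size s)) : (i < j)%N -> f i ∘ f j = 0.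
      move=> i j; rewrite neq_ltn => /orP[/lt//|/lt]; rewrite jmulC; exact.
    move=> ij; apply/eqP.
    have := pairwiseP (0, 0) orth i j (ltn_ord i) (ltn_ord j) ij.
    by rewrite /f !(tnth_nth (0, 0)).
  - by rewrite -sum (big_tnth _ _ s).
(* Invariance of the rank identifies the length of the list with [n]. *)
have sn := frame_size ff fe; subst n.
exists (map_tuple fst (in_tuple s)); split.
  by rewrite /= sorted_map; apply: sub_sorted srt.
exists f; split=> //.
by rewrite {1}xE (big_tnth _ _ s); apply: eq_bigr => i _; rewrite tnth_map.
Qed.

(** Existence makes [xget] return a witness rather than its default. *)
Lemma eigenvaluesP n x : has_rank V n ->
  sorted >=%R (eigenvalues n x) /\
  exists f : 'I_n -> V,
    jordan_frame f /\ x = \sum_(i < n) tnth (eigenvalues n x) i *: f i.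
Proof.
move=> /(sorted_spectral x) h.
exact: (@xgetPex _ (nseq_tuple n 0) [set l : n.-tuple R | sorted >=%R l /\
  exists f : 'I_n -> V, jordan_frame f /\ x = \sum_(i < n) tnth l i *: f i]%classic).
Qed.

(** Eigenvalues of an idempotent are 0 or 1. A frame element with eigenvalue 1 lies on the line of
    [c], hence equals [c], and orthogonality makes all other eigenvalues 0. *)
Lemma jtrace_primitive n c : has_rank V n -> jprimitive c -> jtrace n c = 1.
Proof.
move=> rk prim; have [_ [h [fh cE]]] := eigenvaluesP c rk.
rewrite /jtrace; move: (tnth _) cE => l cE; have [c0 cc _] := prim.
have ch j : c ∘ h j = l j *: h j by rewrite cE frame_comb_mul.
have [j lj] : exists j, l j != 0.
  apply: contrapT => hl; apply: c0; rewrite cE big1 // => i _.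
  have [->|li] := eqVneq (l i) 0; first by rewrite scale0r.
  by case: hl; exists i.
have lE k : l k != 0 -> l k = 1.
  have := frame_comb_dot fh (fun i => l i * l i) k.
  have -> : \sum_i (l i * l i) *: h i = c.
    rewrite -[RHS]cc {2}cE jmul_sumr; apply: eq_bigr => i _.
    by rewrite jmulZr ch scalerA.
  rewrite {1}cE frame_comb_dot // => /(mulIf (lt0r_neq0 (frame_norm_gt0 fh k))) lk l0.
  by apply: (mulfI l0); rewrite mulr1 -lk.
have hj : c ∘ h j = h j by rewrite ch lE // scale1r.
have [a ha] := primitive_line prim hj.
have hc : h j = c.
  have := frame_idempotent fh j; rewrite /jidempotent ha !linE cc => /eqP.
  rewrite scalerA -subr_eq0 -scalerBl scaler_eq0 => /orP[|/eqP//].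
  rewrite -[X in _ * _ - X]mulr1 -mulrBr mulf_eq0 subr_eq0 => /orP[/eqP a0|/eqP->].
    by case: (frame_primitive fh j); rewrite ha a0 scale0r.
  by rewrite scale1r.
rewrite (bigD1 j) //= lE // big1 ?addr0 // => k kj.
have := frame_comb_dot fh l k; rewrite -cE -hc frame_dot // 1?eq_sym // => /esym/eqP.
by rewrite mulf_eq0 (gt_eqF (frame_norm_gt0 fh k)) orbF => /eqP.
Qed.

End Frame.

(** * Schur products *)

Section SchurProduct.
Context {R : realType} {V : euclideanJordanAlgebra R}.
Variables (n : nat) (e : 'I_n -> V).
Hypothesis fe : jordan_frame e.
Implicit Types (x y z w : V) (i j k l : 'I_n) (A B : 'M[R]_n).

Lemma frame_comm i j x : e i ∘ (e j ∘ x) = e j ∘ (e i ∘ x).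
Proof.
have [->//|ij] := eqVneq i j; apply: (@peirce_comm _ _ _ _ _ 0).
- exact: frame_idempotent.
- by rewrite eqxx.
- by rewrite frame_mul // scale0r.
Qed.

(* Multiplication by [e k] and [e l] halves vectors of the off-diagonal Peirce
   space, whence the factor 4. *)
Definition peirce_proj i j x : V :=
  if i == j then peirce1 (e i) x else 4 *: (e i ∘ (e j ∘ x)).

Lemma frame_peirce1_mul i j x : i != j -> e j ∘ peirce1 (e i) x = 0.
Proof.
move=> ij; rewrite jmulC; apply: (@peirce10 _ _ (e i)).
- exact: frame_idempotent.
- by apply: peirce1P; apply: frame_idempotent.
- exact: frame_mul.
Qed.

Lemma mem_peirce_space i j x : reflect
  (if i == j then e i ∘ x = x else e i ∘ x = 2^-1 *: x /\ e j ∘ x = 2^-1 *: x)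
  (x \in peirce_space e i j).
Proof.
rewrite /peirce_space; case: eqP => _.
  by rewrite mem_leigenspace_jmul scale1r; apply: eqP.
rewrite memv_cap !mem_leigenspace_jmul.
by apply: (iffP andP) => -[/eqP h1 /eqP h2]; split=> //; apply/eqP.
Qed.

Lemma peirce_proj_mem i j x : peirce_proj i j x \in peirce_space e i j.
Proof.
apply/mem_peirce_space; rewrite /peirce_proj; case: eqVneq => [_|ij].
  by apply: peirce1P; apply: frame_idempotent.
have half k l : k != l -> e k ∘ (4 *: (e k ∘ (e l ∘ x))) = 2^-1 *: (4 *: (e k ∘ (e l ∘ x))).
  move=> kl; have := frame_peirce1_mul x kl; rewrite /peirce1 !linE ![e l ∘ (e k ∘ _)]frame_comm.
  by move=> h; jlra h.
split; first exact: half.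
by rewrite [e i ∘ (e j ∘ x)]frame_comm half // eq_sym.
Qed.

(** The coefficient is half the number of endpoints of (k, l) equal to [i], a diagonal pair counting
    twice. *)
Lemma frame_mul_peirce k l y i : y \in peirce_space e k l ->
  e i ∘ y = (((i == k)%:R + (i == l)%:R) / 2) *: y.
Proof.
move/mem_peirce_space; have [->{k}|kl] := eqVneq k l.
  move=> h; case: eqVneq => [->|il].
    by rewrite -mulr2n -mulr_natr mul1r divff ?scale1r ?pnatr_eq0.
  rewrite addr0 mul0r scale0r jmulC; apply: (@peirce10 _ _ (e l)) => //.
    exact: frame_idempotent.
  by rewrite frame_mul // eq_sym.
case=> hk hl; have [->|ik] := eqVneq i k.
  by rewrite (negPf kl) addr0 mul1r.
have [->|il] := eqVneq i l; first by rewrite add0r mul1r.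
(* For [i] distinct from [k] and [l], [y] lies in the 1-space of the idempotent [e k + e l] and
   [e i] in its 0-space. *)
rewrite addr0 mul0r scale0r jmulC; apply: (@peirce10 _ _ (e k + e l)).
- rewrite /jidempotent !linE [e l ∘ e k]jmulC (frame_mul fe kl) (frame_idempotent fe k)
    (frame_idempotent fe l).
  by rewrite addr0 add0r.
- by rewrite !linE hk hl; jlin.
- by rewrite !linE !frame_mul ?addr0 // eq_sym.
Qed.

Lemma peirce_proj_on i j k l y : (i <= j)%N -> (k <= l)%N ->
  y \in peirce_space e k l ->
  peirce_proj i j y = if (i == k) && (j == l) then y else 0.
Proof.
move=> ij kl yk; rewrite /peirce_proj /peirce1.
rewrite !(frame_mul_peirce _ yk) !linE !(frame_mul_peirce _ yk) !scalerA.
case: (eqVneq i j) ij => [->{i}|nij] ij.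
- case: (eqVneq j k) kl {yk} => [->{j ij}|jk] kl /=.
    case: eqVneq => kl' /=; apply: dot_inj => w; rewrite ?linE; lra.
  by case: eqVneq => jl /=; apply: dot_inj => w; rewrite ?linE; lra.
- have {}ij : (i < j)%N by rewrite ltn_neqAle nij.
  have h1 : (i == k) && (j == k) = false.
    by apply/negP => /andP[/eqP ik /eqP jk]; rewrite ik jk ltnn in ij.
  have h2 : (i == l) && (j == l) = false.
    by apply/negP => /andP[/eqP il /eqP jl]; rewrite il jl ltnn in ij.
  (* Swapped indices name the same Peirce space; i < j together with k <= l excludes them. *)
  have h3 : (i == l) && (j == k) = false.
    apply/negP => /andP[/eqP il /eqP jk]; rewrite il jk in ij.
    by have := leq_trans ij kl; rewrite ltnn.
  case: (i == k) h1 h2 h3; case: (j == k); case: (i == l); case: (j == l) => //= _ _ _;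
  by apply: dot_inj => w; rewrite ?linE; lra.
Qed.

Lemma peirce_projD i j x y : peirce_proj i j (x + y) = peirce_proj i j x + peirce_proj i j y.
Proof. by rewrite /peirce_proj /peirce1; case: eqP => _; jlin. Qed.

Lemma peirce_projZ i j (a : R) x : peirce_proj i j (a *: x) = a *: peirce_proj i j x.
Proof. by rewrite /peirce_proj /peirce1; case: eqP => _; jlin. Qed.

Lemma peirce_proj_sumr i j I (r : seq I) (P : pred I) (F : I -> V) :
  peirce_proj i j (\sum_(k <- r | P k) F k) = \sum_(k <- r | P k) peirce_proj i j (F k).
Proof.
have p0 : peirce_proj i j 0 = 0 by rewrite -(scale0r 0) peirce_projZ !scale0r.
exact: (big_morph _ (peirce_projD i j) p0).
Qed.

Lemma peirce_proj_adj i j x y : ⟨peirce_proj i j x, y⟩ = ⟨x, peirce_proj i j y⟩.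
Proof.
rewrite /peirce_proj /peirce1; case: eqP => _; rewrite [RHS]dotC !linE !dot_mulA.
  by rewrite ![⟨y, _⟩]dotC !dot_mulA.
by congr (_ * _); rewrite [RHS]dotC !dot_mulA frame_comm.
Qed.

(** Passes between the upper triangle, which indexes the Peirce components, and all ordered pairs,
    where symmetric forms live. *)
Lemma sum_upper (W : lmodType R) (F G : 'I_n -> 'I_n -> W) :
  (forall i, G i i = F i i) -> (forall i j, i != j -> G i j = F i j + F j i) ->
  \sum_(p : 'I_n * 'I_n | (p.1 <= p.2)%N) G p.1 p.2 = \sum_i \sum_j F i j.
Proof.
move=> Gd Go; rewrite [RHS]pair_big /=.
rewrite [RHS](bigID (fun p : 'I_n * 'I_n => (p.1 <= p.2)%N)) /=.
have -> : \sum_(p : 'I_n * 'I_n | ~~ (p.1 <= p.2)%N) F p.1 p.2 =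
    \sum_(p : 'I_n * 'I_n | (p.1 <= p.2)%N && (p.1 != p.2)) F p.2 p.1.
  rewrite (reindex_inj (h := fun p : 'I_n * 'I_n => (p.2, p.1))) /=; last first.
    by case=> a b [c d] [-> ->].
  by apply: eq_bigl => p; rewrite -ltnNge ltn_neqAle andbC.
rewrite [X in _ + X]big_mkcondr -big_split /=; apply: eq_bigr => -[i j] _ /=.
by case: eqVneq => [->|/Go//]; rewrite Gd addr0.
Qed.

Lemma peirce_proj_sum x :
  \sum_(p : 'I_n * 'I_n | (p.1 <= p.2)%N) peirce_proj p.1 p.2 x = x.
Proof.
rewrite (@sum_upper V (fun i j => if i == j then peirce1 (e i) x else 2 *: (e i ∘ (e j ∘ x)))
  (fun i j => peirce_proj i j x)); last first.
- move=> i j ij; rewrite /peirce_proj (negPf ij) eq_sym (negPf ij)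
    [e j ∘ (e i ∘ x)]frame_comm; jlin.
- by move=> i; rewrite /peirce_proj eqxx.
rewrite -[RHS](jmul1x x) -(frame_sum fe) jmul_suml; apply: eq_bigr => i _.
(* Inserting the unit and expanding it in the frame, the term j = i completes [peirce1 (e i) x] and
   the others are the off-diagonal terms. *)
transitivity (2 *: (e i ∘ ((\sum_j e j) ∘ x)) - e i ∘ x); last first.
  by rewrite (frame_sum fe) jmul1x; jlin.
rewrite (bigD1 i) //= [\sum_j e j](bigD1 i) //= eqxx /peirce1 !linE jmul_suml jmul_sumr.
rewrite scalerDr scaler_sumr addrAC; congr (_ + _ + _).
by apply: eq_bigr => j ji; rewrite eq_sym (negPf ji).
Qed.

(** Applied to [x] written as the sum of its [sumv_pi] components, [peirce_proj i j] kills all but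
    the one at (i, j). *)
Lemma peirce_compE i j x : (i <= j)%N -> peirce_comp e i j x = peirce_proj i j x.
Proof.
move=> ij; pose U := (\sum_(p : 'I_n * 'I_n | (p.1 <= p.2)%N) peirce_space e p.1 p.2)%VS.
have xU : x \in U.
  rewrite -(peirce_proj_sum x); apply: memv_sumr => -[k l] /= kl.
  exact: peirce_proj_mem.
rewrite -{2}(sumv_pi_sum (erefl U) xU) peirce_proj_sumr (bigD1 (i, j)) //= big1 ?addr0.
  rewrite (peirce_proj_on ij ij) ?eqxx //.
  exact: (memv_sum_pi (erefl U) (i, j)).
move=> [k l] /andP[/= kl kl']; rewrite (peirce_proj_on ij kl).
  by case: ifP => // /andP[/eqP ik /eqP jl]; rewrite ik jl eqxx in kl'.
exact: (memv_sum_pi (erefl U) (k, l)).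
Qed.

Lemma schurE A x : schur e A x =
  \sum_(p : 'I_n * 'I_n | (p.1 <= p.2)%N) A p.1 p.2 *: peirce_proj p.1 p.2 x.
Proof. by apply: eq_bigr => p pp; rewrite peirce_compE. Qed.

Lemma schur_adj A x y : ⟨schur e A x, y⟩ = ⟨x, schur e A y⟩.
Proof.
rewrite !schurE dot_suml dot_sumr; apply: eq_bigr => p _.
by rewrite dotZl dotZr peirce_proj_adj.
Qed.

Lemma schur_one A : (forall i, A i i = 1) -> schur e A (jone V) = jone V.
Proof.
move=> A1; rewrite schurE -[RHS]peirce_proj_sum; apply: eq_bigr => -[i j] /= _.
have [->|ij] := eqVneq i j; first by rewrite A1 scale1r.
by rewrite /peirce_proj (negPf ij) jmulx1 frame_mul // !scaler0.
Qed.

Lemma schur_schur A B x :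
  schur e A (schur e B x) = schur e (\matrix_(i, j) (A i j * B i j)) x.
Proof.
rewrite !schurE; apply: eq_bigr => -[i j] /= ij; rewrite mxE -scalerA; congr (_ *: _).
rewrite peirce_proj_sumr (bigD1 (i, j)) //= big1 ?addr0.
  by rewrite peirce_projZ (peirce_proj_on ij ij) ?eqxx ?peirce_proj_mem.
move=> [k l] /andP[/= kl kl']; rewrite peirce_projZ (peirce_proj_on ij kl) ?peirce_proj_mem //.
case: ifP; rewrite ?scaler0 // => /andP[/eqP ik /eqP jl].
by rewrite ik jl eqxx in kl'.
Qed.

Lemma schur_sumr A I (r : seq I) (P : pred I) (F : I -> V) :
  schur e A (\sum_(k <- r | P k) F k) = \sum_(k <- r | P k) schur e A (F k).
Proof.
under [RHS]eq_bigr do rewrite schurE.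
rewrite schurE [RHS]exchange_big /=; apply: eq_bigr => p _.
by rewrite peirce_proj_sumr scaler_sumr.
Qed.

Lemma schurZ A (a : R) x : schur e A (a *: x) = a *: schur e A x.
Proof.
rewrite !schurE scaler_sumr; apply: eq_bigr => p _.
by rewrite peirce_projZ !scalerA mulrC.
Qed.

(** When [s] enumerates all indices, this is the quadratic representation of sum_i u_i e_i. *)
Definition stretch_all (u : 'I_n -> R) (s : seq 'I_n) x :=
  foldr (fun i y => stretch (e i) (u i) y) x s.

Lemma jpos_stretch_all u s x : jpos x -> jpos (stretch_all u s x).
Proof.
by move=> px; elim: s => //= i s IH; apply: jpos_stretch => //; apply: frame_idempotent.
Qed.

Lemma stretch_all_sum u s I (r : seq I) (P : pred I) (F : I -> V) :
  stretch_all u s (\sum_(k <- r | P k) F k) = \sum_(k <- r | P k) stretch_all u s (F k).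
Proof.
elim: s => //= i s ->.
have sD : {morph stretch (e i) (u i) : x y / x + y}.
  by move=> x y; rewrite /stretch; jlin.
have s0 : stretch (e i) (u i) 0 = 0.
  by rewrite /stretch !linE !scaler0 subr0 scaler0 !addr0.
exact: (big_morph _ sD s0).
Qed.

(** Each factor contributes u_i once for every endpoint of (k, l) equal to i; over all indices the
    product is u_k u_l. *)
Lemma stretch_all_peirce u s k l y : y \in peirce_space e k l ->
  stretch_all u s y = (\prod_(i <- s) (u i ^+ (i == k) * u i ^+ (i == l))) *: y.
Proof.
move=> yk; elim: s => [|i s IH] /=; first by rewrite big_nil scale1r.
rewrite IH big_cons /stretch !linE (frame_mul_peirce i yk) !linE (frame_mul_peirce i yk).
by case: (i == k); case: (i == l); apply: dot_inj => w; rewrite /= ?linE ?expr1 ?expr0; field.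
Qed.

Lemma schur_rank1 (u : 'I_n -> R) x :
  schur e (\matrix_(i, j) (u i * u j)) x = stretch_all u (index_enum 'I_n) x.
Proof.
rewrite -[in RHS](peirce_proj_sum x) stretch_all_sum schurE.
apply: eq_bigr => -[k l] /= _; rewrite mxE (stretch_all_peirce _ _ (peirce_proj_mem k l x)).
congr (_ *: _); rewrite big_split /=.
have prodE j : \prod_i u i ^+ (i == j) = u j.
  by rewrite (bigD1 j) //= eqxx expr1 big1 ?mulr1 // => i /negPf ->.
by rewrite !prodE.
Qed.

Lemma jpos_schur_rank1 (u : 'I_n -> R) x :
  jpos x -> jpos (schur e (\matrix_(i, j) (u i * u j)) x).
Proof. by rewrite schur_rank1; apply: jpos_stretch_all. Qed.

(** Off-diagonal terms are halved because a sum over ordered pairs meets each of them twice. *)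
Definition peirce_pairing x y i j : R :=
  if i == j then ⟨peirce_proj i j x, y⟩ else ⟨peirce_proj i j x, y⟩ / 2.

Lemma peirce_pairing_sym x y i j : peirce_pairing x y i j = peirce_pairing x y j i.
Proof.
rewrite /peirce_pairing eq_sym; case: eqVneq => [->//|ij].
by rewrite /peirce_proj (negPf ij) eq_sym (negPf ij) frame_comm.
Qed.

Lemma schur_dot A x y : A^T = A ->
  ⟨schur e A x, y⟩ = \sum_i \sum_j A i j * peirce_pairing x y i j.
Proof.
move=> symA; rewrite schurE dot_suml.
rewrite -(@sum_upper R^o _ (fun i j => A i j * ⟨peirce_proj i j x, y⟩)).
- by apply: eq_bigr => p _; rewrite dotZl.
- by move=> i; rewrite /peirce_pairing eqxx.
- move=> i j ij; have -> : A j i = A i j by rewrite -{1}symA mxE.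
  rewrite [peirce_pairing x y j i]peirce_pairing_sym -mulrDr.
  by rewrite /peirce_pairing (negPf ij) -splitr.
Qed.

End SchurProduct.

(** * Positive semidefinite matrices and majorization *)

Section Psd.
Context {R : realFieldType} {n : nat}.
Implicit Types (C D : 'I_n -> 'I_n -> R) (u v : 'I_n -> R).

Definition quad C u := \sum_i \sum_j u i * u j * C i j.

Definition psd_form C := (forall i j, C i j = C j i) /\ forall u, 0 <= quad C u.

Lemma quad_shift C u t i : (forall i j, C i j = C j i) ->
  quad C (fun j => u j + t * (j == i)%:R)
  = quad C u + 2 * t * (\sum_j u j * C i j) + t ^+ 2 * C i i.
Proof.
move=> symC; pose r j := \sum_k u k * C j k.
have quadE (v : 'I_n -> R) : quad C v = \sum_j v j * \sum_k v k * C j k.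
  by apply: eq_bigr => j _; rewrite mulr_sumr; apply: eq_bigr => k _; rewrite mulrA.
have delta (F : 'I_n -> R) : \sum_k (u k + t * (k == i)%:R) * F k
    = \sum_k u k * F k + t * F i.
  under eq_bigr do rewrite mulrDl; rewrite big_split /=; congr (_ + _).
  rewrite (bigD1 i) //= eqxx mulr1 big1 ?addr0 // => k /negPf ->.
  by rewrite mulr0 mul0r.
rewrite !quadE delta.
under eq_bigr do rewrite delta mulrDr.
rewrite big_split /= delta.
have -> : \sum_k u k * (t * C k i) = t * \sum_k u k * C i k.
  by rewrite mulr_sumr; apply: eq_bigr => k _; rewrite mulrCA symC.
ring.
Qed.

Lemma psd_diag_ge0 C i : psd_form C -> 0 <= C i i.
Proof.
move=> [symC psdC]; have := psdC (fun j => 0 + 1 * (j == i)%:R).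
rewrite (quad_shift (fun=> 0)) // /quad.
do 2! [rewrite big1 ?mulr0; last by move=> j _; rewrite ?big1 // => *; rewrite !mul0r].
by rewrite !add0r expr1n mul1r.
Qed.

(** Otherwise the form at e_j + t e_i would be affine and nonconstant in t, hence negative
    somewhere. *)
Lemma psd_diag0 C i j : psd_form C -> C i i = 0 -> C i j = 0.
Proof.
move=> hC Ci; have [symC psdC] := hC.
have row k : \sum_l (0 + 1 * (l == j)%:R) * C k l = C k j.
  rewrite (bigD1 j) //= eqxx add0r !mul1r big1 ?addr0 // => l /negPf ->.
  by rewrite mulr0 addr0 mul0r.
have qj : quad C (fun l => 0 + 1 * (l == j)%:R) = C j j.
  rewrite (quad_shift (fun=> 0)) // /quad.
  do 2! [rewrite big1 ?mulr0; last by move=> k _; rewrite ?big1 // => *; rewrite !mul0r].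
  by rewrite !add0r expr1n mul1r.
apply: contrapT => /eqP cij.
(* This value of t makes the form equal to -1. *)
have := psdC (fun l => (0 + 1 * (l == j)%:R) + (- (C j j + 1) / (2 * C i j)) * (l == i)%:R).
rewrite (quad_shift (fun l => 0 + 1 * (l == j)%:R)) // row qj Ci.
suff -> : 2 * (- (C j j + 1) / (2 * C i j)) * C i j = - (C j j + 1) by lra.
by field.
Qed.

(* Schur complement: subtracting the rank one form of a pivot row keeps [C]
   positive semidefinite and kills the pivot. *)
Lemma psd_pivot C i : psd_form C -> C i i != 0 ->
  psd_form (fun j k => C j k - C i j * C i k / C i i).
Proof.
move=> [symC psdC] Ci; split=> [j k|u]; first by rewrite symC [C i j * _]mulrC.
have -> : quad (fun j k => C j k - C i j * C i k / C i i) u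
    = quad C u - (\sum_j u j * C i j) ^+ 2 / C i i.
  rewrite /quad expr2 mulr_suml mulr_suml -sumrB; apply: eq_bigr => j _.
  rewrite mulr_sumr mulr_suml -sumrB; apply: eq_bigr => k _.
  by field.
(* The shift minimises the form along coordinate [i]. *)
have := psdC (fun j => u j + - (\sum_j u j * C i j) / C i i * (j == i)%:R).
rewrite quad_shift //; set r := \sum_j _.
suff -> : quad C u + 2 * (- r / C i i) * r + (- r / C i i) ^+ 2 * C i i
  = quad C u - r ^+ 2 / C i i by [].
by field.
Qed.

(** Induction on the number of nonzero diagonal entries of [C]: a pivot splits off a rank one part,
    whose pairing with [D] is a nonnegative multiple of a value of the form [D]. With zero diagonal,
    [C] vanishes. *)
Lemma psd_pairing_ge0 C D : psd_form C -> psd_form D ->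
  0 <= \sum_i \sum_j C i j * D i j.
Proof.
move=> + psdD; have [m] := ubnP #|[set i | C i i != 0]|.
elim: m C => // m IH C; rewrite ltnS => sC psdC.
have [[i Ci]|noC] := pselect (exists i, C i i != 0); last first.
  rewrite big1 // => i _; rewrite big1 // => j _; rewrite (psd_diag0 j psdC) ?mul0r //.
  by apply: contrapT => /eqP Ci; apply: noC; exists i.
pose C' j k := C j k - C i j * C i k / C i i.
have h : 0 <= \sum_j \sum_k C' j k * D j k.
  apply: IH; last exact: psd_pivot.
  apply: leq_trans sC; apply/proper_card/properP; split.
    apply/fintype.subsetP => j; rewrite !inE; apply: contra_neq => Cj.
    have [symC _] := psdC.
    by rewrite /C' Cj [C i j]symC (psd_diag0 i psdC Cj) !mul0r subr0.
  by exists i; rewrite !inE // negbK /C' mulfK // subrr.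
have -> : \sum_j \sum_k C j k * D j k =
    \sum_j \sum_k C' j k * D j k + quad D (C i) / C i i.
  rewrite /quad mulr_suml -big_split; apply: eq_bigr => j _ /=.
  rewrite mulr_suml -big_split; apply: eq_bigr => k _ /=.
  by rewrite /C'; field.
by rewrite addr_ge0 // divr_ge0 ?psd_diag_ge0 //; case: psdD.
Qed.

Lemma psd_hadamard C D : psd_form C -> psd_form D ->
  psd_form (fun i j => C i j * D i j).
Proof.
move=> psdC [symD psdD]; have [symC _] := psdC; split=> [i j|u]; first by rewrite symC symD.
have -> : quad (fun i j => C i j * D i j) u = \sum_i \sum_j C i j * (u i * u j * D i j).
  by apply: eq_bigr => i _; apply: eq_bigr => j _; rewrite mulrCA.
apply: psd_pairing_ge0 => //; split=> [i j|v]; first by rewrite symD [u i * _]mulrC.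
have -> : quad (fun i j => u i * u j * D i j) v = quad D (fun i => v i * u i); last exact: psdD.
by apply: eq_bigr => i _; apply: eq_bigr => j _; ring.
Qed.

End Psd.

(** * Correlation matrices and their entrywise powers *)

Section CorrelationMatrix.
Context {R : realType} {n : nat}.
Implicit Types C D : 'M[R]_n.

Lemma psdmx_form C : C^T = C -> psdmx C -> psd_form C.
Proof.
move=> symC psdC; split=> [i j|u]; first by rewrite -{1}symC mxE.
have := psdC (\col_i u i); congr (_ <= _).
rewrite mxE; under eq_bigr do rewrite mxE mulr_suml.
rewrite exchange_big /=; apply: eq_bigr => i _; apply: eq_bigr => j _.
by rewrite !mxE mulrAC.
Qed.

Lemma psd_form_mx C : psd_form C -> psdmx C.
Proof.
move=> [_ psdC] u; have := psdC (fun i => u i 0); congr (_ <= _).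
rewrite mxE; under [RHS]eq_bigr do rewrite mxE mulr_suml.
rewrite [RHS]exchange_big /=; apply: eq_bigr => i _; apply: eq_bigr => j _.
by rewrite !mxE mulrAC.
Qed.

Lemma correlation_entry_exp k C : (0 < k)%N -> correlation_mx C ->
  correlation_mx (entry_exp k C).
Proof.
move=> k0 [symC psdC diagC]; split.
- by apply/matrixP => i j; rewrite !mxE -{1}symC mxE.
- have fC := psdmx_form symC psdC.
  apply: psd_form_mx; case: k k0 => // k _; elim: k => [|k IH].
    by have -> : entry_exp 1 C = C by apply/matrixP => i j; rewrite mxE.
  have := psd_hadamard fC IH; congr psd_form.
  by apply/funext => i; apply/funext => j; rewrite !mxE -exprS.
- by move=> i; rewrite mxE diagC expr1n.
Qed.

End CorrelationMatrix.

(** * Majorization from doubly stochastic matrices *)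

Section Majorization.
Context {R : realType}.

Lemma decr_sorted n (l : n.-tuple R) (i : 'I_n) : sorted >=%R l -> decr l i = tnth l i.
Proof.
move=> srt; rewrite /decr sorted_sort // ?(tnth_nth 0) //.
by move=> x y z xy yz; apply: le_trans xy.
Qed.

(** The column sums [w] of the first [k] rows lie in [0, 1] and add up to [k], so moving their mass
    to weight 1 on the [k] largest entries of [l] can only increase the weighted sum. *)
Lemma doubly_stochastic_majorized n (l m : n.-tuple R) (D : 'I_n -> 'I_n -> R) :
  sorted >=%R l -> sorted >=%R m -> (forall i j, 0 <= D i j) ->
  (forall i, \sum_j D i j = 1) -> (forall j, \sum_i D i j = 1) ->
  (forall i, tnth m i = \sum_j D i j * tnth l j) -> majorized m l.
Proof.
move=> sl sm D0 Drow Dcol mE.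
have total : \sum_(i < n) tnth m i = \sum_(i < n) tnth l i.
  under eq_bigr do rewrite mE.
  rewrite exchange_big /=; apply: eq_bigr => j _.
  by rewrite -mulr_suml Dcol mul1r.
split; last by rewrite (eq_bigr _ (fun i _ => decr_sorted i sm))
  (eq_bigr _ (fun i _ => decr_sorted i sl)).
move=> k /andP[k0 kn].
have cut (t : n.-tuple R) : sorted >=%R t ->
    \sum_(i < k) decr t i = \sum_(i < n | (i < k)%N) tnth t i.
  move=> st; rewrite (big_ord_widen n (decr t) kn).
  by apply: eq_bigr => i _; rewrite decr_sorted.
rewrite !cut //; pose w j := \sum_(i < n | (i < k)%N) D i j.
have kn' : (k.-1 < n)%N by rewrite prednK.
(* The threshold is the k-th largest entry, at 0-based index k - 1. *)
pose a := tnth l (Ordinal kn').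
have -> : \sum_(i < n | (i < k)%N) tnth m i = \sum_j w j * tnth l j.
  under eq_bigr do rewrite mE.
  by rewrite exchange_big /=; apply: eq_bigr => j _; rewrite mulr_suml.
have w1 j : w j <= 1.
  rewrite -(Dcol j) /w [leRHS](bigID (fun i : 'I_n => (i < k)%N)) /= lerDl sumr_ge0 //.
have w0 j : 0 <= w j by apply: sumr_ge0.
have sw : \sum_j w j = \sum_(j < n) (j < k)%N%:R.
  rewrite exchange_big /= [RHS](bigID (fun i : 'I_n => (i < k)%N)) /= [X in _ + X]big1 ?addr0.
    by apply: eq_bigr => i ->; rewrite Drow.
  by move=> i /negPf ->.
rewrite [leRHS]big_mkcond /= -subr_ge0.
(* Both weights have the same total, so subtracting [a] from every entry changes nothing; the two
   factors of each term then agree in sign. *)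
have -> : \sum_(j < n) (if (j < k)%N then tnth l j else 0) - \sum_j w j * tnth l j
  = \sum_(j < n) ((j < k)%N%:R - w j) * (tnth l j - a).
  under [RHS]eq_bigr do rewrite mulrBr; rewrite [RHS]sumrB.
  rewrite -[X in _ = _ - X]mulr_suml [X in _ = _ - X * _]sumrB -sw subrr mul0r subr0.
  rewrite -sumrB; apply: eq_bigr => j _; rewrite mulrBl; congr (_ - _).
  by case: ifP => _; rewrite ?mul1r ?mul0r.
have mono (i j : 'I_n) : (i <= j)%N -> tnth l j <= tnth l i.
  move=> ij; rewrite !(tnth_nth 0).
  apply: (sorted_leq_nth _ _ _ sl); rewrite ?inE ?size_tuple //.
    by move=> x y z xy yz; apply: le_trans xy.
  by move=> x; apply: lexx.
apply: sumr_ge0 => j _; have [jk|kj] := ltnP j k.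
  by rewrite mulr_ge0 // subr_ge0 //; apply: mono; rewrite /= -ltnS prednK.
rewrite sub0r mulNr -mulrN opprB mulr_ge0 // subr_ge0; apply: mono.
by rewrite /= (leq_trans (leq_pred k)).
Qed.

End Majorization.

(** * Positivity and majorization for Schur products *)

Section Main.
Context {R : realType} {V : euclideanJordanAlgebra R}.

(** The form [peirce_pairing x y] at [u] is the pairing of [y] with the Schur product of [x] by u
    u^T, nonnegative by the rank one case; it then pairs nonnegatively with [C]. *)
Lemma schur_pos n (e : 'I_n -> V) (C : 'M[R]_n) (x y : V) : jordan_frame e ->
  C^T = C -> psdmx C -> jpos x -> jprimitive y -> 0 <= ⟨schur e C x, y⟩.
Proof.
move=> fe symC psdC px prim; rewrite schur_dot //.
apply: psd_pairing_ge0; first exact: psdmx_form.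
split=> [i j|u]; first exact: peirce_pairing_sym.
have := jpos_schur_rank1 fe u px prim; rewrite schur_dot //; last first.
  by apply/matrixP => i j; rewrite !mxE mulrC.
congr (_ <= _); apply: eq_bigr => i _; apply: eq_bigr => j _.
by rewrite mxE.
Qed.

Lemma schur_correlation_majorized n (e : 'I_n -> V) (C : 'M[R]_n) (y : V) :
  (forall x y : V, ⟨x, y⟩ = jtrace n (x ∘ y)) -> jordan_frame e ->
  correlation_mx C -> jmajorized n (schur e C y) y.
Proof.
move=> dot_trace fe [symC psdC diagC].
have rk : has_rank V n by exists e.
(* The trace form gives primitive idempotents norm 1. *)
have norm1 (h : 'I_n -> V) i : jordan_frame h -> ⟨h i, h i⟩ = 1.
  move=> fh; rewrite dot_trace (frame_idempotent fh i).
  exact: jtrace_primitive (frame_primitive fh i).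
have [sl [g [fg yE]]] := eigenvaluesP y rk.
have [sm [f [ff zE]]] := eigenvaluesP (schur e C y) rk.
apply: (@doubly_stochastic_majorized _ _ _ _ (fun i j => ⟨schur e C (g j), f i⟩)) => //.
- move=> i j; apply: schur_pos => //; last exact: frame_primitive.
  exact/idempotent_pos/frame_idempotent.
(* Rows sum to 1 since a frame adds up to the unit, which the Schur product by [C] fixes; columns
   follow by self-adjointness. *)
- move=> i; rewrite -dot_suml -schur_sumr // frame_sum // schur_one // dotC.
  by rewrite frame_dot1 // norm1.
- move=> j; rewrite -dot_sumr frame_sum // schur_adj // schur_one //.
  by rewrite frame_dot1 // norm1.
- move=> i; have := frame_comb_dot ff (tnth (eigenvalues n (schur e C y))) i.
  rewrite -zE norm1 // mulr1 => <-.
  rewrite {1}yE schur_sumr // dot_suml; apply: eq_bigr => j _.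
  by rewrite schurZ // dotZl mulrC.
Qed.

End Main.

Theorem theorem3p2 (R : realType) (V : euclideanJordanAlgebra R) (n : nat)
    (rankV : has_rank V n)
    (dot_trace : forall x y : V, jdot V x y = jtrace n (jmul V x y))
    (e : 'I_n -> V) (frame_e : jordan_frame e)
    (A B : 'M[R]_n) (symA : A^T = A) (symB : B^T = B)
    (B_neq0 : forall i j, B i j != 0)
    (corrAB : correlation_mx (\matrix_(i, j) (A i j / B i j)))
    (k : nat) (k_ge1 : (1 <= k)%N) :
  (forall x : V,
     jmajorized n (schur e (entry_exp k A) x) (schur e (entry_exp k B) x)) /\
  ((forall i j, A i j != 0) ->
   forall x : V,
     jmajorized n (schur e (entry_expN k B) x) (schur e (entry_expN k A) x)).
Proof.
have corr := correlation_entry_exp k_ge1 corrAB.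
set E := entry_exp k _ in corr.
split=> [x|A_neq0 x].
  have -> : entry_exp k A = \matrix_(i, j) (E i j * entry_exp k B i j).
    apply/matrixP => i j; rewrite !mxE expr_div_n divfK //.
    by rewrite expf_neq0.
  by rewrite -schur_schur //; apply: schur_correlation_majorized.
(* Since (a / b)^k a^(-k) = b^(-k), the same correlation matrix serves with the roles exchanged. *)
have -> : entry_expN k B = \matrix_(i, j) (E i j * entry_expN k A i j).
  apply/matrixP => i j; rewrite !mxE expr_div_n mulrAC divff ?mul1r //.
  by rewrite expf_neq0.
by rewrite -schur_schur //; apply: schur_correlation_majorized.
Qed.
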